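(* Let the kernel $\gamma$ be radial, nonnegative and symmetric with $0<\int_{-\delta}^{\delta}s^2\gamma(s)\,ds<\infty$. Let $(u_h,q_h)$, with $u_h(\cdot,t)\in V_h^k$ and $q_h(\cdot,t;s)\in V_h^k$ for $s\in(0,\delta]$, be a solution of the semi-discrete DG scheme: for every $j=1,\dots,N$, every $s\in(0,\delta]$, every $t$, and all $v_h,w_h\in V_h^k$, $$\int_{I_j}(u_h)_{tt}\,v_h\,dx-2\int_0^\delta s^2\gamma(s)\,\mathcal K_j(q_h,v_h;s)\,ds=0,\qquad \int_{I_j}q_h\,w_h\,dx-\mathcal H_j(u_h,w_h;s)=0 .$$ Define the discrete energy $$E_h(t):=\int_a^b\tfrac12\big((u_h(x,t))_t\big)^2dx+\int_0^\delta s^2\gamma(s)\int_a^b q_h^2(x,t;s)\,dx\,ds .$$ Then $E_h(t)$ is conserved: $E_h(t)=E_h(0)$ for all $t>0$.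
   Context: Setting: the one-dimensional nonlocal wave equation $u_{tt}(x,t)+\mathcal L_\delta u(x,t)=0$ on $(a,b)\times(0,T)$, with periodic boundary conditions and initial data $u(\cdot,0)=u_0$, $u_t(\cdot,0)=u_1$, where $\mathcal L_\delta u(x,t)=-2\int_{x-\delta}^{x+\delta}(u(y,t)-u(x,t))\gamma(x-y)\,dy$, $\delta>0$ is the horizon, and $\gamma(x,y)=\gamma(x-y)$ is a nonnegative symmetric (even) kernel. Mesh and space: $(a,b)$ is divided into subintervals $I_j=(x_{j-1/2},x_{j+1/2})$, $j=1,\dots,N$, $a=x_{1/2}<\dots<x_{N+1/2}=b$, $h_j=|I_j|$, $h=\max_j h_j$; the partition is regular, i.e. $\nu\max_j h_j\le\min_j h_j$ for a positive constant $\nu$. $V_h^k$ is the space of functions whose restriction to each $I_j$ is a polynomial of degree at most $k$ ($k\ge 0$ an integer). All functions are extended periodically with period $b-a$, so that shifted values $v(x\pm s)$ make sense. Operators: for $s>0$, $$\mathcal H_j(v,w;s)=\int_{I_j}\tfrac1s\big(v(x+s)-v(x)\big)w(x)\,dx,\qquad \mathcal K_j(v,w;s)=\int_{I_j}\tfrac1s\big(v(x)-v(x-s)\big)w(x)\,dx .$$ *)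

(* Defs.v *)
From HB Require Import structures.
From mathcomp Require Import all_boot all_order all_algebra.
From mathcomp Require Import all_classical all_reals all_analysis.
Set Implicit Arguments.
Unset Strict Implicit.
Unset Printing Implicit Defensive.
Import Order.TTheory GRing.Theory Num.Theory.
Import numFieldNormedType.Exports.
Local Open Scope classical_set_scope.
Local Open Scope ring_scope.

(* In one dimension a radial kernel is an even one. [gamma] may be singular at
   the origin: its value at the single point 0 plays no role. *)
Definition admissible_kernel (R : realType) (delta : R) (gamma : R -> R) :=
  [/\ measurable_fun setT gamma,
      forall s, 0 <= gamma s,
      forall s, gamma (- s) = gamma s &
      (0 < \int[lebesgue_measure]_(s in `[(- delta)%R, delta]%classic)
             (s ^+ 2 * gamma s)%R%:E < +oo)%E].

(* [xs i] is the node x_{i+1/2} for i = 0, ..., N (values of [xs] beyond N are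
   never used), and cells are numbered from 0, so [cell xs j] is I_{j+1}. *)
Definition is_mesh (R : realType) (a b : R) (N : nat) (xs : nat -> R) :=
  [/\ (0 < N)%N, xs 0%N = a, xs N = b &
      forall j, (j < N)%N -> xs j < xs j.+1].

Definition cell (R : realType) (xs : nat -> R) (j : nat) : set R :=
  `]xs j, xs j.+1[%classic.

Definition cell_size (R : realType) (xs : nat -> R) (j : nat) : R :=
  xs j.+1 - xs j.

Definition max_size (R : realType) (N : nat) (xs : nat -> R) : R :=
  \big[Num.max/0]_(j < N) cell_size xs j.

(* [max_size N xs] is neutral for the minimum of the cell sizes. *)
Definition min_size (R : realType) (N : nat) (xs : nat -> R) : R :=
  \big[Num.min/max_size N xs]_(j < N) cell_size xs j.

Definition regular_mesh (R : realType) (nu : R) (N : nat) (xs : nat -> R) :=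
  nu * max_size N xs <= min_size N xs.

(* Its elements are (b - a)-periodic functions on the whole line. The cells are
   open: values at the nodes are unconstrained. *)
Definition Vh (R : realType) (a b : R) (N : nat) (xs : nat -> R) (k : nat) :
    set (R -> R) :=
  [set v | periodic v (b - a) /\
     forall j, (j < N)%N -> exists p : {poly R},
       (size p <= k.+1)%N /\ forall x, cell xs j x -> v x = p.[x]].

Definition Hop (R : realType) (xs : nat -> R) (j : nat) (v w : R -> R) (s : R)
    : R :=
  \int[lebesgue_measure]_(x in cell xs j) (s^-1 * (v (x + s) - v x) * w x).

Definition Kop (R : realType) (xs : nat -> R) (j : nat) (v w : R -> R) (s : R)
    : R :=
  \int[lebesgue_measure]_(x in cell xs j) (s^-1 * (v x - v (x - s)) * w x).

Definition time_interval (R : realType) (T : \bar R) : set R :=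
  [set t | 0 <= t /\ (t%:E < T)%E].

(* Difference quotients only use times in [D]: with [D] = [0, T) this is the
   usual derivative for t > 0 (see [derive_within_interior]) and the right one at
   t = 0. *)
Definition derivable_within (R : realType) (D : set R) (f : R -> R) (t : R) :=
  cvg (h^-1 * (f (h + t) - f t) @[h --> within [set h | D (h + t)] 0^']).

Definition derive_within (R : realType) (D : set R) (f : R -> R) (t : R) : R :=
  lim (h^-1 * (f (h + t) - f t) @[h --> within [set h | D (h + t)] 0^']).

Lemma within_shift_interior (R : realType) (D : set R) (t : R) :
  D° t -> within [set h | D (h + t)] (0 : R)^' = 0^'.
Proof.
move=> Dt; have D0 : \forall h \near (0 : R), D (h + t).
  have : (h + t) @[h --> (0 : R)] --> t.
    rewrite -{2}(add0r t); apply: cvgD; first exact: cvg_id.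
    exact: cvg_cst.
  exact.
apply/seteqP; split => A; rewrite /within /=; last first.
  by apply: filterS => h Ah _.
move=> PA; have : \forall h \near (0 : R)^', D (h + t).
  by move: D0; apply: filterS.
by move: PA; apply: filterS2 => h + Dh; exact.
Qed.

Lemma derive_within_interior (R : realType) (D : set R) (f : R -> R) (t : R) :
  D° t -> derive_within D f t = f^`()%classic t.
Proof. by move=> Dt; rewrite /derive_within within_shift_interior. Qed.

(* [u x t] stands for u(x,t). *)
Definition dt (R : realType) (T : \bar R) (u : R -> R -> R) : R -> R -> R :=
  fun x t => derive_within (time_interval T) (u x) t.

(* Twice differentiable in time at every point of the open cells; the values at
   the nodes are irrelevant. *)
Definition twice_derivable_in_time (R : realType) (N : nat) (xs : nat -> R)
    (T : \bar R) (u : R -> R -> R) :=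
  forall j x t, (j < N)%N -> cell xs j x -> time_interval T t ->
    derivable_within (time_interval T) (u x) t /\
    derivable_within (time_interval T) (dt T u x) t.

(* [u x t] stands for u_h(x,t) and [q x t s] for q_h(x,t;s). *)
Definition DG_solution (R : realType) (a b : R) (N : nat) (xs : nat -> R)
    (k : nat) (delta : R) (gamma : R -> R) (T : \bar R)
    (u : R -> R -> R) (q : R -> R -> R -> R) :=
  [/\ (forall t, time_interval T t -> Vh a b N xs k (u ^~ t)),
      (forall t s : R, time_interval T t -> 0 < s <= delta ->
         Vh a b N xs k (fun x => q x t s)),
      twice_derivable_in_time N xs T u,
      (forall j t v, (j < N)%N -> time_interval T t -> Vh a b N xs k v ->
         \int[lebesgue_measure]_(x in cell xs j) (dt T (dt T u) x t * v x)
         - 2 * \int[lebesgue_measure]_(s in `]0, delta]%classic)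
                 (s ^+ 2 * gamma s * Kop xs j (fun x => q x t s) v s) = 0) &
      (forall j (t s : R) w, (j < N)%N -> time_interval T t -> 0 < s <= delta ->
         Vh a b N xs k w ->
         \int[lebesgue_measure]_(x in cell xs j) (q x t s * w x)
         - Hop xs j (u ^~ t) w s = 0)].

Definition energy (R : realType) (a b delta : R) (gamma : R -> R) (T : \bar R)
    (u : R -> R -> R) (q : R -> R -> R -> R) (t : R) : R :=
  \int[lebesgue_measure]_(x in `]a, b[%classic) (2^-1 * dt T u x t ^+ 2)
  + \int[lebesgue_measure]_(s in `]0, delta]%classic)
      (s ^+ 2 * gamma s
       * \int[lebesgue_measure]_(x in `]a, b[%classic) (q x t s ^+ 2)).

(* Main.v *)
Require Import Defs.
From mathcomp Require Import all_boot all_order all_algebra.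
From mathcomp Require Import all_classical all_reals all_analysis.
From mathcomp Require Import measurable_realfun qpoly ring lra.
Set Implicit Arguments.
Unset Strict Implicit.
Unset Printing Implicit Defensive.
Import Order.TTheory GRing.Theory Num.Theory.
Import numFieldNormedType.Exports.
Local Open Scope classical_set_scope.
Local Open Scope ring_scope.

(** In a basis of [Vh], with row vectors [c], [r] of coefficients of [u_h], [q_h(.;s)], mass
    matrix [M] and matrix [G(s)] of the form [v, w |-> (1/s) int (v(x+s) - v(x)) w(x) dx], the second
    equation of the scheme reads [r M = c G(s)]. By periodicity the form of [Kop] has the matrix
    [- G(s)^T], so [Kop] applied to [q_h] is [- c B(s)] and [int q_h^2 = c B(s) c^T], where
    [B(s) = G(s) M^-1 G(s)^T] is symmetric. Elements of [Vh] have an L^1 modulus of continuity of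
    order [s], so [G(s)] is bounded and [B(s)] can be integrated against [s^2 gamma(s)]; with [A] the
    resulting symmetric matrix the scheme is the oscillator [c'' M = - 2 c A], whose energy
    [c' M c'^T / 2 + c A c^T] is constant. *)

(** * Preliminaries on periodic functions and polynomials *)

Lemma periodicz (R : numDomainType) (f : R -> R) (p : R) : periodic f p ->
  forall (z : int) x, f (x + z%:~R * p) = f x.
Proof.
move=> fp [n|n] x; first by rewrite -pmulrn mulr_natl periodicn.
by rewrite -(periodicn fp n.+1) NegzE mulrNz mulNr -pmulrn mulr_natl subrK.
Qed.

(** The increment of [p * 'X + c] splits as in the product rule, so induction on the Horner form
    builds the new constant from the old one and a bound of [p] on the disk. *)
Lemma poly_lipschitz (R : realType) (p : {poly R}) (r : R) :
  exists L : R, 0 <= L /\ forall x y, `|x| <= r -> `|y| <= r ->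
    `|p.[y] - p.[x]| <= L * `|y - x|.
Proof.
elim/poly_ind: p => [|p c [L [L0 Lp]]].
  by exists 0; split=> // x y _ _; rewrite !horner0 subrr normr0 mul0r.
have [B pB] := poly_disk_bound p r.
(* Absolute values, since neither [r] nor [B] is known to be nonnegative. *)
exists (L * `|r| + `|B|); split; first by rewrite addr_ge0// mulr_ge0.
move=> x y xr yr; rewrite !hornerMXaddC.
have -> : p.[y] * y + c - (p.[x] * x + c) =
  (p.[y] - p.[x]) * y + p.[x] * (y - x) by ring.
apply: le_trans (ler_normD _ _) _; rewrite [leRHS]mulrDl !normrM lerD//.
  rewrite mulrAC ler_pM// ?Lp//; exact: le_trans yr (ler_norm _).
by rewrite ler_wpM2r// (le_trans (pB x xr))// ler_norm.
Qed.

(** * Translation invariance of the Lebesgue integral *)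

Section lebesgue_shift.
Variable R : realType.
Implicit Types (f : R -> R) (a b s : R).
Notation mu := (@lebesgue_measure R).

Lemma measurable_shift s : measurable_fun [set: R] (fun x : R => x + s).
Proof. by apply: measurable_funD. Qed.

(** The Lebesgue measure is determined by its values on half-open intervals, and the preimage of
    such an interval under a translation has the same length. *)
Lemma lebesgue_measureD s (A : set R) : measurable A ->
  pushforward mu (fun x : measurableTypeR R => x + s : measurableTypeR R) A = mu A.
Proof.
move=> mA.
apply/esym/lebesgue_measure_unique => //=; first exact: measurable_shift.
move=> _ _ [[c d]] _ <-.
rewrite /pushforward (_ : _ @^-1` _ = `]c - s, d - s]%classic); last first.
  by apply/seteqP; split=> x /=; rewrite !in_itv/= ltrBlDr lerBrDr.
rewrite !lebesgue_measure_itv/= !lte_fin ltrD2r.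
by case: ifP => // _; congr EFin; ring.
Qed.

(** Change of variables through the pushforward measure, which translation invariance identifies
    with the Lebesgue measure. *)
Lemma Rintegral_shift a b s f :
  mu.-integrable `]a, b[ (fun x => (f (x + s))%:E) -> measurable_fun setT f ->
  \int[mu]_(x in `]a, b[) f (x + s) = \int[mu]_(x in `]a + s, b + s[) f x.
Proof.
move=> fi mf; rewrite /Rintegral; congr fine.
have pre : (fun x => x + s) @^-1` `]a + s, b + s[%classic = `]a, b[%classic.
  by apply/seteqP; split=> x /=; rewrite !in_itv/= !ltrD2r.
have := @integral_pushforward _ _ (measurableTypeR R) (measurableTypeR R) R
  (fun x => x + s) (measurable_shift s) mu `]a + s, b + s[%classic (EFin \o f).
rewrite pre => <-//; last exact/measurable_EFinP.
apply: eq_measure_integral => [|? A mA _]; first exact: measurable_shift.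
exact: (lebesgue_measureD s mA).
Qed.

End lebesgue_shift.

(** * Integrals of finite sums, and bounded measurable functions *)

Lemma integrable_Rsum d (T : measurableType d) (R : realType)
    (mu : {measure set T -> \bar R}) (D : set T) (I : Type) (r : seq I)
    (f : I -> T -> R) : measurable D ->
  (forall i, mu.-integrable D (EFin \o f i)) ->
  mu.-integrable D (EFin \o (fun x => \sum_(i <- r) f i x)).
Proof.
move=> mD fi; have := integrable_sum mD r (P := xpredT) (fun i _ => fi i).
rewrite (_ : (fun x => _) = EFin \o (fun x => \sum_(i <- r) f i x))//.
by apply/funext => x /=; rewrite sumEFin.
Qed.

Lemma Rintegral_sum d (T : measurableType d) (R : realType)
    (mu : {measure set T -> \bar R}) (D : set T) (I : Type) (r : seq I)
    (f : I -> T -> R) : measurable D ->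
  (forall i, mu.-integrable D (EFin \o f i)) ->
  \int[mu]_(x in D) (\sum_(i <- r) f i x) = \sum_(i <- r) \int[mu]_(x in D) f i x.
Proof.
move=> mD fi; elim: r => [|i r IH].
  rewrite big_nil; under eq_Rintegral do rewrite big_nil.
  by rewrite Rintegral_cst// mul0r.
rewrite big_cons -IH -RintegralD//; last exact: integrable_Rsum.
by apply: eq_Rintegral => x _; rewrite big_cons.
Qed.

(** Boundedness gives integrability on bounded intervals, and preserves it under multiplication with
    an integrable weight that may itself be unbounded, such as the one built from the kernel. *)
Definition bmeas (R : realType) (D : set R) (f : R -> R) :=
  measurable_fun D f /\ exists B, forall x, D x -> `|f x| <= B.

Section bmeas.
Variables (R : realType) (D : set R).
Implicit Types f g : R -> R.

Lemma bmeas_cst c : bmeas D (fun=> c).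
Proof. by split=> //; exists `|c|. Qed.

Lemma bmeasD f g : bmeas D f -> bmeas D g -> bmeas D (fun x => f x + g x).
Proof.
move=> [mf [B fB]] [mg [C gC]]; split; first exact: measurable_funD.
by exists (B + C) => x Dx; rewrite (le_trans (ler_normD _ _))// lerD ?fB ?gC.
Qed.

Lemma bmeasM f g : bmeas D f -> bmeas D g -> bmeas D (fun x => f x * g x).
Proof.
move=> [mf [B fB]] [mg [C gC]]; split; first exact: measurable_funM.
by exists (B * C) => x Dx; rewrite normrM ler_pM ?fB ?gC.
Qed.

Lemma bmeas_sum (I : Type) (r : seq I) (f : I -> R -> R) :
  (forall i, bmeas D (f i)) -> bmeas D (fun x => \sum_(i <- r) f i x).
Proof.
move=> bf; elim: r => [|i r IH].
  have := bmeas_cst 0; congr (bmeas D _); apply/funext => x; by rewrite big_nil.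
have := bmeasD (bf i) IH; congr (bmeas D _); apply/funext => x; by rewrite big_cons.
Qed.

Lemma bmeas_mulmx m n p (A : R -> 'M[R]_(m, n)) (B : R -> 'M[R]_(n, p)) :
  (forall i j, bmeas D (fun s => A s i j)) ->
  (forall i j, bmeas D (fun s => B s i j)) ->
  forall i j, bmeas D (fun s => (A s *m B s) i j).
Proof.
move=> bA bB i j; have := bmeas_sum (index_enum _) (fun l => bmeasM (bA i l) (bB l j)).
by congr (bmeas D _); apply/funext => s; rewrite mxE.
Qed.

End bmeas.

(* This class is stable under translations and products, so integrals over one period of
   expressions in such functions can be manipulated freely *)
Definition tame (R : realType) (a b : R) (f : R -> R) :=
  periodic f (b - a) /\ bmeas setT f.

Definition intp (R : realType) (a b : R) (f : R -> R) : R :=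
  \int[@lebesgue_measure R]_(x in `]a, b[%classic) f x.

(** * Integration over one period *)

Section tame.
Variables (R : realType) (a b : R).
Hypothesis ab : a < b.
Implicit Types (f g : R -> R) (c s : R).
Notation mu := (@lebesgue_measure R).
Notation tame := (tame a b).
Notation intp := (intp a b).

Lemma tame_cst c : tame (fun=> c).
Proof. by split=> //; exact: bmeas_cst. Qed.

Lemma tameD f g : tame f -> tame g -> tame (fun x => f x + g x).
Proof.
by move=> [fp bf] [gp bg]; split; [move=> x; rewrite fp gp|exact: bmeasD].
Qed.

Lemma tameM f g : tame f -> tame g -> tame (fun x => f x * g x).
Proof.
by move=> [fp bf] [gp bg]; split; [move=> x; rewrite fp gp|exact: bmeasM].
Qed.

Lemma tameZ c f : tame f -> tame (fun x => c * f x).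
Proof. by move=> ?; apply: tameM => //; exact: tame_cst. Qed.

Lemma tameB f g : tame f -> tame g -> tame (fun x => f x - g x).
Proof.
move=> tf tg; have := tameD tf (tameZ (-1) tg).
by congr (tame _); apply/funext => x; rewrite mulN1r.
Qed.

Lemma tame_sum (I : Type) (r : seq I) (f : I -> R -> R) :
  (forall i, tame (f i)) -> tame (fun x => \sum_(i <- r) f i x).
Proof.
move=> tf; split; last by apply: bmeas_sum => i; have [] := tf i.
by move=> x; apply: eq_bigr => i _; have [-> _] := tf i.
Qed.

Lemma tame_norm f : tame f -> tame (fun x => `|f x|).
Proof.
move=> [fp [mf [B fB]]]; split; first by move=> x; rewrite fp.
by split; [exact: measurableT_comp|exists B => x _; rewrite normr_id fB].
Qed.

Lemma tame_shift s f : tame f -> tame (fun x => f (x + s)).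
Proof.
move=> [fp [mf [B fB]]]; split; first by move=> x; rewrite addrAC fp.
split; last by exists B => x _; exact: fB.
by apply: measurableT_comp => //; exact: measurable_shift.
Qed.

Lemma bmeas_integrable (c d : R) f : bmeas `]c, d[ f -> mu.-integrable `]c, d[ (EFin \o f).
Proof.
move=> [mf [B fB]]; apply: measurable_bounded_integrable => //.
  by rewrite /= lebesgue_measure_itv/=; case: ifP => // _; rewrite ltry.
by exists B; split; [exact: num_real|move=> M BM x Dx; rewrite /= (le_trans (fB x Dx))// ltW].
Qed.

Lemma tame_integrable (c d : R) f : tame f -> mu.-integrable `]c, d[ (EFin \o f).
Proof.
move=> [_ [mf [B fB]]]; apply: bmeas_integrable; split; first exact: measurable_funTS.
by exists B => x _; exact: fB.
Qed.

Lemma intpB f g : tame f -> tame g ->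
  intp (fun x => f x - g x) = intp f - intp g.
Proof. by move=> tf tg; rewrite /intp RintegralB//; exact: tame_integrable. Qed.

Lemma intpZ c f : tame f -> intp (fun x => c * f x) = c * intp f.
Proof. by move=> tf; rewrite /intp RintegralZl//; exact: tame_integrable. Qed.

Lemma intp_sum (I : Type) (r : seq I) (f : I -> R -> R) :
  (forall i, tame (f i)) ->
  intp (fun x => \sum_(i <- r) f i x) = \sum_(i <- r) intp (f i).
Proof. by move=> tf; rewrite /intp Rintegral_sum// => i; exact: tame_integrable. Qed.

Lemma eq_intp f g : (forall x, a < x < b -> f x = g x) -> intp f = intp g.
Proof. by move=> fg; apply: eq_Rintegral => x; rewrite inE/= in_itv/=; exact: fg. Qed.

Lemma le_intp f g : tame f -> tame g -> (forall x, a < x < b -> f x <= g x) ->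
  intp f <= intp g.
Proof.
by move=> tf tg fg; apply: le_Rintegral => //; exact: tame_integrable.
Qed.

Lemma ler_norm_intp f : tame f -> `|intp f| <= intp (fun x => `|f x|).
Proof. by move=> tf; apply: le_normr_Rintegral => //; exact: tame_integrable. Qed.

(** The point [d] belongs to neither open piece, but a single point has measure zero. *)
Lemma Rintegral_split c d e f : tame f -> c <= d -> d <= e ->
  \int[mu]_(x in `]c, e[) f x =
  \int[mu]_(x in `]c, d[) f x + \int[mu]_(x in `]d, e[) f x.
Proof.
move=> tf cd de; case: (ltgtP d e) de => // [de _|-> _]; last first.
  by rewrite (@set_itv_ge _ _ (BRight e) (BLeft e)) ?bnd_simp ?ltxx// Rintegral_set0 addr0.
have fi u v : mu.-integrable `]u, v[ (EFin \o f) by exact: tame_integrable.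
by rewrite -(Rintegral_itvB (fi c e) (x := d)) ?bnd_simp// -Rintegral_itv_bndo_bndc// addrC subrK.
Qed.

(* Reduce the shift modulo the period, then move the overhanging piece back by one period *)
Lemma intp_shift s f : tame f -> intp (fun x => f (x + s)) = intp f.
Proof.
move=> tf; have [fp [mf _]] := tf.
have P0 : 0 < b - a by rewrite subr_gt0.
pose z := Num.floor (s / (b - a)); pose r := s - z%:~R * (b - a).
have /andP[r0 rP] : 0 <= r < b - a.
  have /andP[] := floor_itv (s / (b - a)); rewrite -/z ler_pdivlMr// ltr_pdivrMr//.
  by rewrite intrD mulrDl mul1r /r => ? ?; lra.
transitivity (intp (fun x => f (x + r))).
  apply: eq_intp => x _; rewrite -(periodicz fp z (x + r)); congr f.
  by rewrite /r; ring.
rewrite /intp Rintegral_shift//; last exact/tame_integrable/tame_shift.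
rewrite (@Rintegral_split _ b) ?lerDl//; last by lra.
rewrite (@Rintegral_split a (a + r) b) ?lerDl//; last by lra.
rewrite addrC; congr (_ + _).
have := @Rintegral_shift _ a (a + r) (b - a) f _ mf.
rewrite (_ : a + (b - a) = b); last by ring.
rewrite (_ : a + r + (b - a) = b + r); last by ring.
move=> <-; first by apply: eq_Rintegral => x _; exact: fp.
exact/tame_integrable/tame_shift.
Qed.

End tame.

(** * Mesh geometry and regularity of piecewise polynomials *)

Section mesh.
Variables (R : realType) (a b : R) (N : nat) (xs : nat -> R) (k : nat).
Hypothesis hmesh : is_mesh a b N xs.
Implicit Types (x y s : R) (v w : R -> R) (i j : nat).
Notation mu := (@lebesgue_measure R).
Notation tame := (tame a b).
Notation intp := (intp a b).
Notation Vh := (Vh a b N xs k).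

Lemma xs_le i j : (i <= j <= N)%N -> xs i <= xs j.
Proof.
have [_ _ _ xsS] := hmesh.
elim: j => [|j IH]; first by rewrite leqn0 => /andP[/eqP->].
case/andP; rewrite leq_eqVlt => /predU1P[->//|ij] jN.
by rewrite (le_trans (IH _))// ?(ltW (xsS _ _))// -ltnS ij ltnW.
Qed.

Lemma cell_inj i j x : (i < N)%N -> (j < N)%N -> cell xs i x -> cell xs j x -> i = j.
Proof.
rewrite /cell /= !in_itv/= => iN jN /andP[ix xi] /andP[jx xj].
case: (ltngtP i j) => // ij; exfalso.
  by have := xs_le (i := i.+1) (j := j); rewrite ij ltnW// => /(_ isT); lra.
by have := xs_le (i := j.+1) (j := i); rewrite ij ltnW// => /(_ isT); lra.
Qed.

Lemma cell_sub j x : (j < N)%N -> cell xs j x -> a < x < b.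
Proof.
have [_ <- <- _] := hmesh => jN; rewrite /cell /= in_itv/= => /andP[jx xj].
rewrite (le_lt_trans _ jx) ?(lt_le_trans xj)// xs_le//.
  by rewrite jN leqnn.
by rewrite (ltnW jN).
Qed.

Lemma mesh_cover n x : (n <= N)%N -> a <= x < xs n ->
  exists2 j, (j < n)%N & x = xs j \/ cell xs j x.
Proof.
have [_ <- _ _] := hmesh.
elim: n => [|n IH] nN; first by case/andP=> ax; rewrite ltNge ax.
move=> /andP[ax xn]; have [xn'|] := ltP x (xs n).
  have [|j jn xj] := IH (ltnW nN); first by rewrite ax.
  by exists j => //; exact: ltnW.
rewrite le_eqVlt => /predU1P[<-|nx]; first by exists n => //; left.
by exists n => //; right; rewrite /cell /= in_itv/= nx.
Qed.

Lemma mesh_lt : a < b.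
Proof.
have [N0 <- <- xsS] := hmesh; apply: lt_le_trans (xsS _ N0) _.
by rewrite xs_le// N0 leqnn.
Qed.
Let ab := mesh_lt.

Lemma mesh_coverT x : a <= x < b -> exists2 j, (j < N)%N & x = xs j \/ cell xs j x.
Proof. by have [_ _ <- _] := hmesh; exact: mesh_cover. Qed.

(* The representative of [x] modulo the period in [a, b) *)
Definition perrep x : R := x - (Num.floor ((x - a) / (b - a)))%:~R * (b - a).

Lemma perrepP x : a <= perrep x < b.
Proof.
have P0 : 0 < b - a by rewrite subr_gt0.
have /andP[] := floor_itv ((x - a) / (b - a)).
rewrite /perrep; set z := Num.floor _.
by rewrite ler_pdivlMr// ltr_pdivrMr// intrD mulrDl mul1r => ? ?; lra.
Qed.

Lemma perrep_id x : a <= x < b -> perrep x = x.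
Proof.
move=> /andP[ax xb]; rewrite /perrep (@floor_def _ _ 0) ?mul0r ?subr0//.
have P0 : 0 < b - a by rewrite subr_gt0.
by rewrite ler_pdivlMr// ltr_pdivrMr// mul0r mul1r subr_ge0 ax/= ltrD2r.
Qed.

Lemma periodic_perrep v : periodic v (b - a) -> forall x, v (perrep x) = v x.
Proof. by move=> vp x; rewrite /perrep -mulNr -mulrNz periodicz. Qed.

Lemma perrep_periodic : periodic perrep (b - a).
Proof.
move=> x; rewrite /perrep.
have P0 : b - a != 0 by rewrite subr_eq0 gt_eqF.
rewrite (_ : (x + (b - a) - a) / (b - a) = (x - a) / (b - a) + 1); last first.
  by rewrite addrAC mulrDl divff.
by rewrite floorDrz// floor1 intrD; ring.
Qed.

(** The integer part is nondecreasing, hence measurable. *)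
Lemma perrep_measurable : measurable_fun setT perrep.
Proof.
have P0 : 0 < b - a by rewrite subr_gt0.
apply: measurable_funB => //; apply: measurable_funM => //.
apply: nondecreasing_measurable => // x y xy.
by rewrite ler_int le_floor// ler_pM2r ?invr_gt0// lerD2r.
Qed.

(** Measurability and boundedness are checked cell by cell on [a, b) and carried to the whole line
    by composition with [perrep]. The arbitrary values at the finitely many nodes harm neither. *)
Lemma Vh_tame v : Vh v -> tame v.
Proof.
move=> [vp vpoly]; split=> //; split.
  suff mv : measurable_fun `[a, b[ v.
    rewrite (_ : v = v \o perrep); last by apply/funext => x /=; rewrite periodic_perrep.
    apply: (measurable_comp _ _ mv) => //; last exact: perrep_measurable.
    by move=> _ [x _ <-] /=; rewrite in_itv/=; exact: perrepP.
  rewrite (_ : `[a, b[%classic =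
      \bigcup_j (if (j < N)%N then `[xs j, xs j.+1[%classic else set0)); last first.
    apply/seteqP; split=> x /=; rewrite in_itv/=.
      move=> /mesh_coverT[j jN xj]; exists j => //; rewrite jN /= in_itv/=.
      have [_ _ _ xsS] := hmesh.
      case: xj => [->|]; first by rewrite lexx xsS.
      by rewrite /cell /= in_itv/= => /andP[/ltW-> ->].
    move=> [j _]; case: ifP => //= jN; rewrite in_itv/= => /andP[xj jx].
    have [_ <- <- _] := hmesh.
    by rewrite (le_trans _ xj) ?(lt_le_trans jx)// xs_le// ?jN ?leqnn// (ltnW jN).
  apply/measurable_fun_bigcup => [j|j]; first by case: ifP.
  case: ifP => jN; last exact: measurable_fun_set0.
  (* Adding the left node to the open cell does not affect measurability, whatever the value
     there. *)
  apply/measurable_fun_itv_obnd_cbndP; have [p [_ vE]] := vpoly j jN.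
  apply: (eq_measurable_fun (fun x => p.[x])).
    by move=> x; rewrite inE => xj; rewrite vE.
  by apply: measurable_funTS; apply: continuous_measurable_fun; exact: continuous_horner.
suff vB : forall n, (n <= N)%N -> exists B, forall x, a <= x < xs n -> `|v x| <= B.
  have [B vB'] := vB N (leqnn N).
  exists B => x _; rewrite -(periodic_perrep vp) vB'//.
  by have [_ _ -> _] := hmesh; exact: perrepP.
elim=> [_|n IH nN].
  exists 0 => x /andP[ax]; have [_ -> _ _] := hmesh.
  by rewrite ltNge ax.
have [B vB] := IH (ltnW nN).
have [p [_ vE]] := vpoly n nN; have [C pC] := poly_itv_bound p (xs n) (xs n.+1).
exists (Num.max B (Num.max `|v (xs n)| C)) => x /andP[ax xn].
have [nx|xn'|->] := ltgtP (xs n) x; last by rewrite !le_max lexx orbT.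
- rewrite vE; last by rewrite /cell /= in_itv/= nx.
  by rewrite !le_max pC ?orbT// !ltW.
- by rewrite !le_max vB ?ax.
Qed.

(** On each cell this is the Lipschitz bound for a polynomial on a disk containing [a, b]; adding up
    the constants of the cells gives one that serves them all. *)
Lemma Vh_lipschitz v : Vh v -> exists L, 0 <= L /\ forall j x y, (j < N)%N ->
  cell xs j x -> cell xs j y -> `|v y - v x| <= L * `|y - x|.
Proof.
move=> [_ vpoly].
have ler_ab x : a < x < b -> `|x| <= `|a| + `|b|.
  move=> /andP[ax xb]; rewrite ler_norml.
  by have := ler_norm b; have := ler_norm (- a); rewrite normrN;
    have := normr_ge0 a; have := normr_ge0 b; lra.
suff vL : forall n, (n <= N)%N -> exists L, 0 <= L /\ forall j x y, (j < n)%N ->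
    cell xs j x -> cell xs j y -> `|v y - v x| <= L * `|y - x|.
  exact: vL (leqnn N).
elim=> [_|n IH nN]; first by exists 0.
have [L [L0 vL]] := IH (ltnW nN).
have [p [_ vE]] := vpoly n nN; have [M [M0 pM]] := poly_lipschitz p (`|a| + `|b|).
exists (L + M); split; first exact: addr_ge0.
move=> j x y; rewrite ltnS leq_eqVlt mulrDl => /predU1P[->|jn] jx jy.
  rewrite !vE// (le_trans (pM _ _ _ _)) ?lerDr ?mulr_ge0//; apply: ler_ab.
    exact: cell_sub jx.
  exact: cell_sub jy.
by rewrite (le_trans (vL _ _ _ jn jx jy))// lerDl mulr_ge0.
Qed.

Lemma bmeas_indic (D : set R) (c d : R) : bmeas D (\1_(`[c, d]%classic) : R -> R).
Proof.
split; first exact: (measurable_indic (measurable_itv _)).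
by exists 1 => x _; rewrite indicE; case: (_ \in _); rewrite ?normr1 ?normr0.
Qed.

Lemma Rintegral_indic_itv (c s : R) : 0 <= s ->
  \int[mu]_(x in `]a, b[) (\1_(`[c - s, c]%classic) x : R) <= s.
Proof.
move=> s0; rewrite /Rintegral integral_indic//.
have : (mu (`[(c - s)%R, c] `&` `]a, b[) <= s%:E)%E.
  apply: le_trans (le_measure _ _ _ (@subIsetl _ _ _)) _; rewrite ?inE//.
    exact: measurableI.
  rewrite /= lebesgue_measure_itv/= lte_fin; case: ifP => [_|_]; last by rewrite lee_fin.
  by rewrite lee_fin; lra.
move=> H; rewrite -lee_fin fineK// ge0_fin_numE//; exact: le_lt_trans H (ltry _).
Qed.

(* [v] is Lipschitz inside the cells, so only the points at distance at most [s] on the left of a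
   node see a jump; they form a set of measure O(s) *)
Lemma Vh_modulus v : Vh v -> exists C, 0 <= C /\ forall s, 0 < s ->
  intp (fun x => `|v (x + s) - v x|) <= C * s.
Proof.
move=> vVh; have tv := Vh_tame vVh; have [_ [_ [B vB']]] := tv.
have vB x : `|v x| <= B by exact: vB'.
have [L [L0 vL]] := Vh_lipschitz vVh.
have B0 : 0 <= B := le_trans (normr_ge0 _) (vB 0).
(* The Lipschitz bound [L * s] is integrated over a period of length [b - a]; each of the [N.+1]
   nodes adds at most [2 * B] on an interval of length [s]. *)
exists (L * (b - a) + N.+1%:R * (2 * B)); split.
  by rewrite addr_ge0 ?mulr_ge0// ?subr_ge0 1?ltW.
move=> s s0; have s0' := ltW s0.
pose J i : set R := `[xs i - s, xs i]%classic.
pose g i x : R := 2 * B * \1_(J i) x.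
have gi i : mu.-integrable `]a, b[ (EFin \o g i).
  by apply/bmeas_integrable/bmeasM; [exact: bmeas_cst|exact: bmeas_indic].
have gsi : mu.-integrable `]a, b[ (EFin \o (fun x => \sum_(i < N.+1) g i x)).
  exact: (@integrable_Rsum _ (measurableTypeR R) R mu _ _ _
    (fun o : 'I_N.+1 => g o) (measurable_itv _) (fun o => gi o)).
have Li : mu.-integrable `]a, b[ (EFin \o (fun=> L * s)).
  exact: (tame_integrable _ _ (tame_cst a b _)).
apply: (@le_trans _ _ (\int[mu]_(x in `]a, b[) (L * s + \sum_(i < N.+1) g i x))).
  apply: le_Rintegral => //.
  - by apply: (tame_integrable _ _ (tame_norm (tameB (tame_shift _ tv) tv))).
  - exact: (integrableD _ Li gsi).
  move=> x; rewrite /= in_itv/= => /andP[ax xb].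
  have g0 i : 0 <= g i x by rewrite /g mulr_ge0 ?mulr_ge0// indicE.
  (* Close to the node [xs i], the crude bound [2 * B] is absorbed by the indicator attached to that
     node. *)
  have jump i : (i <= N)%N -> xs i - s <= x <= xs i ->
      `|v (x + s) - v x| <= L * s + \sum_(i < N.+1) g i x.
    move=> iN xi; apply: (@le_trans _ _ (2 * B)).
      by rewrite (le_trans (ler_normB _ _))// mulrDl mul1r lerD.
    rewrite (bigD1 (inord i))//= inordK ?ltnS// /g indicE mem_set ?mulr1//.
    by rewrite addrCA lerDl addr_ge0 ?mulr_ge0//; apply: sumr_ge0 => o _; exact: g0.
  have [|j jN [xE|jx]] := mesh_coverT (x := x); first by rewrite xb ltW.
    by apply: (jump j); [exact: ltnW|rewrite xE lexx andbT; lra].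
  (* Either [x + s] is still in the cell of [x], or the right end of that cell lies within distance
     [s] of [x]. *)
  have [xsj|jxs] := ltP (x + s) (xs j.+1).
    have jxs : cell xs j (x + s).
      move: jx; rewrite /cell /= !in_itv/= xsj => /andP[jx _]; rewrite andbT; lra.
    rewrite (le_trans (vL _ _ _ jN jx jxs))// (_ : x + s - x = s); last by ring.
    by rewrite ger0_norm ?lerDl ?sumr_ge0// ltW.
  apply: (jump j.+1) => //.
  by move: jx; rewrite /cell /= in_itv/= => /andP[_ /ltW->]; rewrite andbT lerBlDr.
rewrite RintegralD// (@Rintegral_sum _ (measurableTypeR R) R mu _ _ _
  (fun o : 'I_N.+1 => g o) (measurable_itv _) (fun o => gi o)) Rintegral_cst//=.
rewrite lebesgue_measure_itv/= lte_fin ab/= mulrDl; apply: lerD; first by rewrite mulrAC.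
have gs i : \int[mu]_(x in `]a, b[) g i x <= 2 * B * s.
  rewrite RintegralZl//; last by apply/bmeas_integrable/bmeas_indic.
  by rewrite ler_wpM2l ?mulr_ge0//; exact: Rintegral_indic_itv (ltW s0).
apply: le_trans (ler_sum _ (fun (i : 'I_N.+1) _ => gs i)) _.
by rewrite sumr_const card_ord -[leRHS]mulrA [leRHS]mulr_natl.
Qed.

End mesh.

(** * A nodal basis of the discontinuous space *)

Section nodal_basis.
Variables (R : realType) (a b : R) (N : nat) (xs : nat -> R) (k : nat).
Hypothesis hmesh : is_mesh a b N xs.
Implicit Types (x y s : R) (v w : R -> R) (j l : nat).
Notation mu := (@lebesgue_measure R).
Notation tame := (tame a b).
Notation intp := (intp a b).
Notation Vh := (Vh a b N xs k).
Let ab : a < b := mesh_lt hmesh.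

(** The divisors start at 2, so these points are distinct and strictly inside the cell, away from
    the nodes of the mesh. *)
Definition node j l : R := xs j + (xs j.+1 - xs j) / l.+2%:R.

Lemma node_cell j l : (j < N)%N -> cell xs j (node j l).
Proof.
have [_ _ _ xsS] := hmesh => jN; have := xsS j jN; rewrite -subr_gt0 => h0.
rewrite /cell /= in_itv/= /node ltrDl divr_gt0//= -ltrBrDl ltr_pdivrMr//.
by rewrite ltr_pMr// ltr1n.
Qed.

Lemma node_inj j : (j < N)%N -> injective (node j).
Proof.
have [_ _ _ xsS] := hmesh => jN l1 l2 /addrI.
have h0 : xs j.+1 - xs j != 0 by rewrite subr_eq0 gt_eqF// xsS.
by move/(mulfI h0)/invr_inj/eqP; rewrite eqr_nat => /eqP[].
Qed.

Definition dofs := #|{: 'I_N * 'I_k.+1}|.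
Implicit Types i m : 'I_dofs.
Definition dof_cell i : 'I_N := (enum_val i).1.
Definition dof_node i : R := node (dof_cell i) (enum_val i).2.

(* Lagrange polynomial on its own cell, zero on the other cells and at the mesh nodes *)
Definition shape i x : R :=
  if xs (dof_cell i) < perrep a b x < xs (dof_cell i).+1
  then (tnth (lagrange k.+1 (node (dof_cell i))) (enum_val i).2 : {poly R}).[perrep a b x]
  else 0.

Lemma dof_node_cell i : cell xs (dof_cell i) (dof_node i).
Proof. exact: node_cell. Qed.

Lemma shape_in i j x : (j < N)%N -> cell xs j x -> shape i x =
  if j == dof_cell i then
    (tnth (lagrange k.+1 (node (dof_cell i))) (enum_val i).2 : {poly R}).[x] else 0.
Proof.
move=> jN jx; have /andP[ax xb] := cell_sub hmesh jN jx.
rewrite /shape (perrep_id hmesh) ?xb ?(ltW ax)//; case: eqP => [<-|jni].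
  by move: jx; rewrite /cell /= in_itv/= => ->.
case: ifP => // ix; case: jni.
by apply: (cell_inj hmesh jN (ltn_ord _) jx); rewrite /cell /= in_itv.
Qed.

Lemma shape_out i x : a < x < b -> ~ cell xs (dof_cell i) x -> shape i x = 0.
Proof.
move=> /andP[ax xb] ix; rewrite /shape (perrep_id hmesh) ?xb ?(ltW ax)//.
by case: ifP => // ix'; case: ix; rewrite /cell /= in_itv.
Qed.

Lemma shape_Vh i : Vh (shape i).
Proof.
split; first by move=> x; rewrite /shape (perrep_periodic hmesh).
move=> j jN; exists (if j == dof_cell i then
    (tnth (lagrange k.+1 (node (dof_cell i))) (enum_val i).2 : {poly R}) else 0).
split; last by move=> x jx; rewrite (shape_in _ jN jx); case: eqP; rewrite ?horner0.
by case: eqP => _; rewrite ?size_poly0// size_lagrange_//; exact: node_inj.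
Qed.

(** Within a common cell this is the Lagrange property; between different cells the shape function
    vanishes. *)
Lemma shape_node i m : shape i (dof_node m) = (i == m)%:R.
Proof.
rewrite (shape_in _ (ltn_ord _) (dof_node_cell m)).
case: (eqVneq i m) => [->|im].
  by rewrite eqxx lagrange_sample ?eqxx//; exact: node_inj.
case: eqP => // /val_inj E.
rewrite /dof_node E lagrange_sample//; last exact: node_inj.
rewrite (_ : (_ == _) = false)//; apply/negbTE; apply: contra_neq im => E2.
apply: enum_val_inj; rewrite [LHS]surjective_pairing [RHS]surjective_pairing.
by rewrite -E2; congr (_, _); exact/esym.
Qed.

Lemma shape_comb_Vh (w : 'I_dofs -> R) : Vh (fun x => \sum_i w i * shape i x).
Proof.
split; first by move=> x; apply: eq_bigr => i _; have [-> _] := shape_Vh i.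
move=> j jN; have [p pP] := choice (fun i => (shape_Vh i).2 j jN).
exists (\sum_i w i *: p i); split.
  apply: (leq_trans (size_sum _ _ _)); apply/bigmax_leqP => i _.
  by rewrite (leq_trans (size_scale_leq _ _))//; have [] := pP i.
move=> x jx; rewrite horner_sum; apply: eq_bigr => i _.
by rewrite hornerZ; have [_ ->] := pP i.
Qed.

(** Only the [k.+1] shape functions of the cell survive at [x], and Lagrange interpolation at [k.+1]
    points reproduces polynomials of degree at most [k]. The identity can fail at the mesh nodes,
    where [v] is arbitrary. *)
Lemma Vh_expand v j x : Vh v -> (j < N)%N -> cell xs j x ->
  v x = \sum_i v (dof_node i) * shape i x.
Proof.
move=> [_ vpoly] jN jx; have [p [sp vE]] := vpoly j jN.
under eq_bigr do rewrite (shape_in _ jN jx).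
pose F (e : 'I_N * 'I_k.+1) := v (node e.1 e.2) *
  if j == e.1 then (tnth (lagrange k.+1 (node e.1)) e.2 : {poly R}).[x] else 0.
transitivity (\sum_e F e); last by rewrite (big_enum_val (A := predT)).
rewrite -(pair_bigA _ (fun e1 e2 => F (e1, e2)))/= (bigD1 (Ordinal jN))//=.
rewrite [X in _ + X]big1 ?addr0; last first.
  move=> e ej; rewrite big1// => l _; rewrite /F /= ifF ?mulr0//.
  by apply: contra_neqF ej => /eqP je; apply/val_inj.
rewrite vE// {1}(lagrange_gen (x := node j) (n := k.+1) _ _ sp)//; last exact: node_inj.
rewrite horner_sum; apply: eq_bigr => l _; rewrite /F /= eqxx.
by rewrite hornerM hornerC vE//; exact: node_cell.
Qed.

Lemma shape_tame i : tame (shape i).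
Proof. exact: Vh_tame (shape_Vh i). Qed.

(** The mesh nodes form a finite set, hence a null set. *)
Lemma eq_intp_cells f g : tame f -> tame g ->
  (forall j x, (j < N)%N -> cell xs j x -> f x = g x) -> intp f = intp g.
Proof.
move=> tf tg fg.
pose Z : set R := [set xs j | j in `I_N].
have cZ : countable Z by apply/finite_set_countable/finite_image; exact: finite_II.
have mZ : measurable Z.
  by apply: (@countable_measurable _ (measurableTypeR R)) => // ?; exact: measurable_set1.
rewrite /intp /Rintegral; congr fine.
rewrite (@negligible_integral _ (measurableTypeR R) _ mu _ Z)//; last 2 first.
  exact: tame_integrable tf.
  exact: countable_lebesgue_measure0.
rewrite [RHS](@negligible_integral _ (measurableTypeR R) _ mu _ Z)//; last 2 first.
  exact: tame_integrable tg.
  exact: countable_lebesgue_measure0.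
apply: eq_integral => x; rewrite inE /= in_itv/= => -[/andP[ax xb] xZ].
have [|j jN [xE|jx]] := mesh_coverT hmesh (x := x); first by rewrite xb ltW.
  by case: xZ; exists j.
by rewrite (fg j x).
Qed.

(** Testing with a shape function localizes the integrand to one cell, so the cell integrals of the
    scheme become integrals over a period, where translations are available. *)
Lemma intp_cell f i : (forall x, a < x < b -> ~ cell xs (dof_cell i) x -> f x = 0) ->
  \int[mu]_(x in cell xs (dof_cell i)) f x = intp f.
Proof.
move=> f0; rewrite /intp [LHS]Rintegral_mkcond [RHS]Rintegral_mkcond.
apply: eq_Rintegral => x _; rewrite !patchE.
have iab : cell xs (dof_cell i) x -> a < x < b by exact: (cell_sub hmesh (ltn_ord _)).
case: ifPn => [|]; rewrite ?inE ?notin_setE => ix.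
  by rewrite ifT// inE /= in_itv/= iab.
case: ifPn => //; rewrite inE /= in_itv/= => xab.
by rewrite f0.
Qed.

(** Over a period, the shift by [- s] is the adjoint of the shift by [s]; the duality of [Hop] and
    [Kop] rests on this. *)
Lemma intp_shift_mul f g s : tame f -> tame g ->
  intp (fun x => f (x + s) * g x) = intp (fun x => f x * g (x - s)).
Proof.
move=> tf tg; rewrite -(intp_shift ab s (f := fun x => f x * g (x - s))).
  by apply: eq_intp => x _; rewrite addrK.
by apply: tameM => //; exact: tame_shift.
Qed.

(** * Matrices of translations and difference quotients *)

Definition corr s : 'M[R]_dofs := \matrix_(i, m) intp (fun x => shape i (x + s) * shape m x).
Definition mass : 'M[R]_dofs := corr 0.
Definition coef v : 'rV[R]_dofs := \row_i v (dof_node i).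

Lemma massE i m : mass i m = intp (fun x => shape i x * shape m x).
Proof. by rewrite mxE; apply: eq_intp => x _; rewrite addr0. Qed.

Lemma mass_sym : mass^T = mass.
Proof. by apply/matrixP=> i m; rewrite mxE !massE; apply: eq_intp => x _; rewrite mulrC. Qed.

(* The values of [v] at the mesh nodes are irrelevant even under the shift, since the shift can be
   moved to the other factor *)
Lemma intp_corr v w s : Vh v -> Vh w ->
  intp (fun x => v (x + s) * w x) = (coef v *m corr s *m (coef w)^T) 0 0.
Proof.
move=> vV wV; have tv := Vh_tame hmesh vV; have tw := Vh_tame hmesh wV.
pose I z x := \sum_i z (dof_node i) * shape i x.
have tI z : tame (I z) by apply: tame_sum => i; apply/tameZ/shape_tame.
have IE z j x : Vh z -> (j < N)%N -> cell xs j x -> z x = I z x by exact: Vh_expand.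
transitivity (intp (fun x => I v (x + s) * I w x)).
  transitivity (intp (fun x => v (x + s) * I w x)).
    apply: eq_intp_cells => [||j x jN jx].
    - by apply: tameM => //; exact: tame_shift.
    - by apply: tameM => //; exact: tame_shift.
    - by rewrite (IE w j x).
  rewrite !intp_shift_mul//; apply: eq_intp_cells => [||j x jN jx].
  - by apply: tameM => //; exact: tame_shift.
  - by apply: tameM => //; exact: tame_shift.
  - by rewrite (IE v j x).
pose F i m x := v (dof_node i) * w (dof_node m) * (shape i (x + s) * shape m x).
have tF i m : tame (F i m).
  by apply: tameZ; apply: tameM; [apply/tame_shift|]; exact: shape_tame.
transitivity (intp (fun x => \sum_m \sum_i F i m x)).
  apply: eq_intp => x _; rewrite /I mulr_sumr; apply: eq_bigr => m _.
  by rewrite mulr_suml; apply: eq_bigr => i _; rewrite /F mulrACA.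
rewrite intp_sum; last by move=> m; apply: tame_sum.
rewrite !mxE; apply: eq_bigr => m _; rewrite intp_sum// !mxE mulr_suml.
apply: eq_bigr => i _; rewrite intpZ ?mxE; first by rewrite mulrAC.
by apply: tameM; [apply/tame_shift|]; exact: shape_tame.
Qed.

Lemma intp_mass v w : Vh v -> Vh w ->
  intp (fun x => v x * w x) = (coef v *m mass *m (coef w)^T) 0 0.
Proof.
by move=> vV wV; rewrite -intp_corr//; apply: eq_intp => x _; rewrite addr0.
Qed.

(** If [v] did not vanish at the interpolation point, the Lipschitz bound would keep its absolute
    value above half of the value there on a short interval to the right, and the integral would be
    positive. *)
Lemma Vh_sqr_intp0 v i : Vh v -> intp (fun x => v x ^+ 2) = 0 -> v (dof_node i) = 0.
Proof.
move=> vV; apply: contraPeq => vn0; apply/eqP; rewrite gt_eqF//.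
set y := dof_node i in vn0 *; set c := `|v y|.
have c0 : 0 < c by rewrite normr_gt0.
have [L [L0 vL]] := Vh_lipschitz hmesh vV.
have iy := dof_node_cell i; rewrite -/y in iy.
have := iy; rewrite /cell /= in_itv/= => /andP[iy1 iy2].
have L1 : 0 < L + 1 by lra.
(* The first bound keeps [y + r] inside the cell, the second makes the variation [L * r] at most
   [c / 2]; [L + 1] avoids a division by zero. *)
pose r := Num.min ((xs (dof_cell i).+1 - y) / 2) (c / (2 * (L + 1))).
have r0 : 0 < r.
  by rewrite lt_min !divr_gt0//= ?mulr_gt0// subr_gt0.
have yr : y + r < xs (dof_cell i).+1.
  have : r <= (xs (dof_cell i).+1 - y) / 2 by rewrite ge_min lexx.
  lra.
have Lr : L * r <= c / 2.
  have : r <= c / (2 * (L + 1)) by rewrite ge_min lexx orbT.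
  rewrite ler_pdivlMr ?mulr_gt0// => ?; nra.
have tv2 : tame (fun x => v x ^+ 2).
  by have := tameM (Vh_tame hmesh vV) (Vh_tame hmesh vV).
have [ay yrb] : a <= y /\ y + r <= b.
  have [_ <- <- _] := hmesh; split.
    by rewrite (le_trans _ (ltW iy1))// (xs_le hmesh)//= ltnW.
  by rewrite (le_trans (ltW yr))// (xs_le hmesh)// ltn_ord leqnn.
have yb : y <= b by lra.
have yyr : y <= y + r by lra.
have sq0 c1 d1 : 0 <= \int[mu]_(x in `]c1, d1[) (v x ^+ 2).
  by apply: Rintegral_ge0 => x _; exact: sqr_ge0.
rewrite /intp (Rintegral_split tv2 ay yb) (Rintegral_split tv2 yyr yrb).
apply: (ltr_wpDl (sq0 _ _)); apply: (ltr_wpDr (sq0 _ _)).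
apply: (@lt_le_trans _ _ ((c / 2) ^+ 2 * r)).
  by rewrite mulr_gt0// exprn_gt0// divr_gt0.
have <- : \int[mu]_(x in `]y, y + r[) ((c / 2) ^+ 2) = (c / 2) ^+ 2 * r.
  rewrite Rintegral_cst//= lebesgue_measure_itv/= lte_fin ltrDl r0/=.
  by congr (_ * _); ring.
apply: le_Rintegral => //; first exact: tame_integrable (tame_cst a b _).
  exact: tame_integrable tv2.
move=> x; rewrite /= in_itv/= => /andP[yx xyr].
rewrite -[leRHS]real_normK ?num_real// ler_pXn2r ?nnegrE ?divr_ge0 ?(ltW c0)//.
have jx : cell xs (dof_cell i) x.
  by rewrite /cell /= in_itv/= (lt_trans iy1 yx) (lt_trans xyr yr).
have := vL _ _ _ (ltn_ord _) iy jx; rewrite (ger0_norm (x := x - y)); last by lra.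
have := lerB_dist (v y) (v x); rewrite distrC -/c => ? ?.
have : L * (x - y) <= L * r by rewrite ler_wpM2l//; lra.
lra.
Qed.

(* The kernel of the Gram matrix of the shape functions is trivial, since a function of [Vh] of
   norm zero vanishes at all the interpolation points *)
Lemma mass_unit : mass \in unitmx.
Proof.
suff w0 (w : 'rV_dofs) : w *m mass = 0 -> w = 0.
  rewrite -row_free_unit -kermx_eq0; apply/eqP/row_matrixP => j0; rewrite row0.
  by apply: w0; apply/sub_kermxP; exact: row_sub.
move=> wM.
pose v x := \sum_i w 0 i * shape i x.
have vn m : v (dof_node m) = w 0 m.
  rewrite /v (bigD1 m)//= shape_node eqxx mulr1 big1 ?addr0// => i im.
  by rewrite shape_node (negbTE im) mulr0.
have vV : Vh v by exact: shape_comb_Vh.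
have vw : coef v = w by apply/rowP => m; rewrite mxE vn.
apply/rowP => m; rewrite [RHS]mxE -vn; apply: Vh_sqr_intp0 => //.
by rewrite (intp_mass vV vV) vw wM mul0mx mxE.
Qed.

(** The increment integrates a translate of [d] against a bounded shape function; once the
    translation is undone, the L^1 modulus of continuity applies, although shape functions may
    jump. *)
Lemma corr_lipschitz i m : exists K, 0 <= K /\ forall s r, 0 < r ->
  `|corr (s + r) i m - corr s i m| <= K * r.
Proof.
have ti := shape_tame i; have tm := shape_tame m; have [_ [_ [B mB]]] := tm.
have [C [C0 iC]] := Vh_modulus hmesh (shape_Vh i).
have B0 : 0 <= B := le_trans (normr_ge0 _) (mB 0 I).
exists (B * C); split; first exact: mulr_ge0.
move=> s r r0; rewrite !mxE -intpB; last 2 first.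
  by apply: tameM => //; exact: tame_shift.
  by apply: tameM => //; exact: tame_shift.
pose d x := shape i (x + r) - shape i x.
have td : tame d by apply: tameB => //; exact: tame_shift.
rewrite (eq_intp (g := fun x => d (x + s) * shape m x)); last first.
  by move=> x _; rewrite /d mulrBl (addrA x).
have tdm : tame (fun x => d (x + s) * shape m x).
  by apply: tameM => //; exact: tame_shift.
apply: le_trans (ler_norm_intp tdm) _.
apply: (@le_trans _ _ (intp (fun x => B * `|d (x + s)|))).
  apply: le_intp; [exact: tame_norm|by apply/tameZ/tame_norm/tame_shift|].
  by move=> x _; rewrite normrM mulrC ler_wpM2r// mB.
rewrite intpZ; last by apply/tame_norm/tame_shift.
rewrite (intp_shift ab s (tame_norm td)) -mulrA ler_wpM2l//; exact: iC.
Qed.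

(** Adding [K * s] to a [K]-Lipschitz function makes it nondecreasing, so the entry is a difference
    of two monotone functions. *)
Lemma corr_measurable i m : measurable_fun setT (fun s => corr s i m).
Proof.
have [K [K0 cK]] := corr_lipschitz i m.
rewrite (_ : (fun s => corr s i m) = (fun s => corr s i m + K * s) \- (fun s => K * s)).
  apply: measurable_funB => //; apply: nondecreasing_measurable => // s t.
    rewrite le_eqVlt => /predU1P[->//|st].
    have := cK s (t - s); rewrite subrKC subr_gt0 => /(_ st).
    by rewrite ler_norml => /andP[]; lra.
  by move=> st; rewrite ler_wpM2l.
by apply/funext => s /=; rewrite addrK.
Qed.

(** The matrix [G(s)] of the overview. *)
Definition stiff s : 'M[R]_dofs := s^-1 *: (corr s - mass).

(** Since [mass] is [corr 0], the Lipschitz bound compensates the factor [s^-1] uniformly down to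
    [s = 0]. *)
Lemma stiff_bmeas delta i m : bmeas `]0, delta] (fun s => stiff s i m).
Proof.
have [K [K0 cK]] := corr_lipschitz i m; split.
  rewrite (_ : (fun s => stiff s i m) = (fun s => s^-1 * (corr s i m - mass i m))); last first.
    by apply/funext => s; rewrite !mxE.
  apply: measurable_funM; last first.
    by apply: measurable_funB => //; apply: measurable_funTS; exact: corr_measurable.
  apply: subspace_continuous_measurable_fun => //; apply: continuous_in_subspaceT => s.
  by rewrite inE /= in_itv/= => /andP[s0 _]; apply: inv_continuous; rewrite gt_eqF.
exists K => s; rewrite /= in_itv/= => /andP[s0 _].
have := cK 0 s s0; rewrite add0r => sK.
rewrite /stiff /mass [X in `|X|]mxE [X in _ * X]mxE [X in _ + X]mxE normrM.
by rewrite gtr0_norm ?invr_gt0// mulrC ler_pdivrMr.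
Qed.

Lemma coef_shape m (A : 'M[R]_dofs) v :
  (coef v *m A *m (coef (shape m))^T) 0 0 = (coef v *m A) 0 m.
Proof.
rewrite (_ : (coef (shape m))^T = delta_mx m 0) -?colE ?mxE//.
by apply/colP => i; rewrite !mxE shape_node eqxx andbT eq_sym.
Qed.

Lemma coef_shapel m (A : 'M[R]_dofs) v :
  (coef (shape m) *m A *m (coef v)^T) 0 0 = (coef v *m A^T) 0 m.
Proof.
by rewrite -coef_shape -[coef (shape m) *m A *m _]trmxK [LHS]mxE !trmx_mul !trmxK mulmxA.
Qed.

Lemma cell_massE v m : Vh v ->
  \int[mu]_(x in cell xs (dof_cell m)) (v x * shape m x) = (coef v *m mass) 0 m.
Proof.
move=> vV; rewrite intp_cell; last by move=> x xab xm; rewrite shape_out// mulr0.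
by rewrite intp_mass ?coef_shape//; exact: shape_Vh.
Qed.

Lemma Hop_stiff v m s : Vh v -> Hop xs (dof_cell m) v (shape m) s = (coef v *m stiff s) 0 m.
Proof.
move=> vV; have tv := Vh_tame hmesh vV; have tm := shape_tame m.
rewrite /Hop intp_cell; last by move=> x xab xm; rewrite shape_out// mulr0.
transitivity (s^-1 * (intp (fun x => v (x + s) * shape m x) - intp (fun x => v x * shape m x))).
  rewrite -intpB; [|by apply: tameM => //; exact: tame_shift|exact: tameM].
  rewrite -intpZ; last by apply: tameB; apply: tameM => //; exact: tame_shift.
  by apply: eq_intp => x _; rewrite -mulrBl mulrA.
rewrite intp_corr ?intp_mass ?coef_shape//; try exact: shape_Vh.
by rewrite /stiff -scalemxAr mulmxBr !mxE.
Qed.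

(** Discrete integration by parts: moving the backward shift from [v] to the shape function produces
    minus a forward quotient of the latter, whence the transpose and the sign. *)
Lemma Kop_stiff v m s : Vh v ->
  Kop xs (dof_cell m) v (shape m) s = - (coef v *m (stiff s)^T) 0 m.
Proof.
move=> vV; have tv := Vh_tame hmesh vV; have tm := shape_tame m.
rewrite /Kop intp_cell; last by move=> x xab xm; rewrite shape_out// mulr0.
transitivity (s^-1 * (intp (fun x => v x * shape m x) - intp (fun x => shape m (x + s) * v x))).
  rewrite (intp_shift_mul s tm tv) -intpB; [|exact: tameM|by apply: tameM => //; exact: tame_shift].
  rewrite -intpZ; last by apply: tameB; apply: tameM => //; exact: tame_shift.
  by apply: eq_intp => x _; ring.
rewrite intp_corr ?intp_mass ?coef_shape ?coef_shapel//; try exact: shape_Vh.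
rewrite /stiff linearZ/= linearB/= mass_sym -scalemxAr mulmxBr.
by rewrite [in RHS]mxE [X in - (_ * X)]mxE [X in - (_ * (_ + X))]mxE; ring.
Qed.

(** The matrix [B(s)] of the overview. *)
Definition nonloc s : 'M[R]_dofs := stiff s *m invmx mass *m (stiff s)^T.

Lemma nonloc_sym s : (nonloc s)^T = nonloc s.
Proof. by rewrite /nonloc !trmx_mul trmxK trmx_inv mass_sym mulmxA. Qed.

Lemma nonloc_bmeas delta i m : bmeas `]0, delta] (fun s => nonloc s i m).
Proof.
apply: bmeas_mulmx => {i m} i m.
  apply: bmeas_mulmx => {i m} i m; [exact: stiff_bmeas|exact: bmeas_cst].
have := stiff_bmeas delta m i.
by congr (bmeas _ _); apply/funext => s; rewrite [RHS]mxE.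
Qed.

(** * Elimination of the auxiliary variable *)

Section projected_quotient.
Variables (v q : R -> R) (s : R).
Hypotheses (vV : Vh v) (qV : Vh q).
Hypothesis hq : forall m, \int[mu]_(x in cell xs (dof_cell m)) (q x * shape m x) =
  Hop xs (dof_cell m) v (shape m) s.

(** Testing with [shape m] gives the entry [m] of [r M = c G(s)], and the mass matrix is
    invertible. *)
Lemma coef_quotient : coef q = coef v *m stiff s *m invmx mass.
Proof.
rewrite -[LHS](mulmxK mass_unit); congr (_ *m _).
by apply/rowP => m; rewrite -cell_massE// hq Hop_stiff.
Qed.

Lemma Kop_quotient m : Kop xs (dof_cell m) q (shape m) s = - (coef v *m nonloc s) 0 m.
Proof. by rewrite Kop_stiff// coef_quotient /nonloc !mulmxA. Qed.

(** In [r M r^T] the mass matrix cancels one of the two inverses brought in by [r]. *)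
Lemma intp_sqr_quotient :
  intp (fun x => q x ^+ 2) = (coef v *m nonloc s *m (coef v)^T) 0 0.
Proof.
rewrite (eq_intp (g := fun x => q x * q x)); last by move=> x _; rewrite expr2.
rewrite intp_mass// coef_quotient (mulmxKV mass_unit) /nonloc.
by rewrite !trmx_mul trmx_inv mass_sym !mulmxA.
Qed.

End projected_quotient.

End nodal_basis.

(** * Time derivatives on [0, T), one-sided at 0 *)

Lemma cvg_sum (R : numFieldType) (S : Type) (F : set_system S) {FF : Filter F}
    (I : Type) (r : seq I) (f : I -> S -> R) (l : I -> R) :
  (forall i, f i x @[x --> F] --> l i) ->
  \sum_(i <- r) f i x @[x --> F] --> \sum_(i <- r) l i.
Proof.
move=> fl; elim: r => [|i r IH].
  under eq_fun do rewrite big_nil.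
  by rewrite big_nil; exact: cvg_cst.
under eq_fun do rewrite big_cons.
by rewrite big_cons; exact: cvgD.
Qed.

Section time_derivative.
Variables (R : realType) (T : \bar R).
Notation D := (time_interval T).
Implicit Types (f g : R -> R) (t l : R).

Lemma time_near_right t : D t -> \forall h \near 0^'+, D (h + t).
Proof.
move=> [t0 tT]; have hT : \forall h \near (0 : R), ((h + t)%:E < T)%E.
  case: T tT => [r| |//]; last by move=> _; near=> h; exact: ltry.
  rewrite lte_fin => tr; near=> h.
  by rewrite lte_fin -ltrBrDr; near: h; apply: lt_nbhsl; rewrite subr_gt0.
near=> h; split; first by rewrite addr_ge0//; near: h; exact: nbhs_right_ge.
by near: h; exact: (cvg_within _ hT).
Unshelve. all: by end_near. Qed.

Lemma time_interior t : 0 < t -> (t%:E < T)%E -> D° t.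
Proof.
move=> t0 tT; have Tr : \forall s \near t, (s%:E < T)%E.
  case: T tT => [r| |//]; last by move=> _; near=> h; exact: ltry.
  by rewrite lte_fin => tr; near=> s; rewrite lte_fin; near: s; exact: lt_nbhsl.
rewrite /interior /=; near=> s; split; last by near: s.
by apply: ltW; near: s; exact: lt_nbhsr.
Unshelve. all: by end_near. Qed.

Notation punctured t := (within [set h | D (h + t)] (0 : R)^').

(** Small positive increments are admissible at every time, including 0. This makes the filter of
    the difference quotient proper, so that its limits are unique, and gives access to right
    limits. *)
Lemma punctured_right t : D t -> 0^'+ `=>` punctured t.
Proof.
move=> Dt A; rewrite /within /= => PA.
have : \forall h \near 0^'+, D (h + t) -> A h.
  move: PA; rewrite !near_withinE; apply: filterS => h + h0; apply.
  by rewrite gt_eqF.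
by apply: filterS2 (time_near_right Dt) => h Dh; exact.
Qed.

Lemma punctured_proper t : D t -> ProperFilter (punctured t).
Proof.
move=> Dt; apply: Build_ProperFilter => P0.
by have /filter_ex[] := punctured_right Dt P0.
Qed.

(** An equality of filters, so that both convergence and the value of [lim] carry over, the latter
    even where the quotient diverges. *)
Lemma eq_derive_within f g t : D t -> (forall s, D s -> f s = g s) ->
  (h^-1 * (f (h + t) - f t) @[h --> punctured t]) =
  (h^-1 * (g (h + t) - g t) @[h --> punctured t]).
Proof.
move=> Dt fg; apply/seteqP; split=> A; rewrite /nbhs/= /within/=.
  by apply: filterS => h PA Dh; rewrite /= -!fg//; exact: PA.
by apply: filterS => h PA Dh; rewrite /= !fg//; exact: PA.
Qed.

Lemma derive_within_sum (I : Type) (r : seq I) (F : I -> R -> R) (c : I -> R) t :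
  D t -> (forall i, derivable_within D (F i) t) ->
  derivable_within D (fun s => \sum_(i <- r) F i s * c i) t /\
  derive_within D (fun s => \sum_(i <- r) F i s * c i) t =
    \sum_(i <- r) derive_within D (F i) t * c i.
Proof.
move=> Dt dF; have PF := punctured_proper Dt.
suff H : h^-1 * (\sum_(i <- r) F i (h + t) * c i - \sum_(i <- r) F i t * c i)
    @[h --> punctured t] --> \sum_(i <- r) derive_within D (F i) t * c i.
  by split; [apply/cvg_ex; eexists; exact: H|exact: cvg_lim H].
rewrite (_ : (fun h => _) =
    (fun h => \sum_(i <- r) h^-1 * (F i (h + t) - F i t) * c i)); last first.
  apply/funext => h; rewrite -sumrB mulr_sumr; apply: eq_bigr => i _.
  by rewrite -mulrBl mulrA.
by apply: cvg_sum => i; apply: cvgM; [exact: dF|exact: cvg_cst].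
Qed.

Lemma derive_within_is_derive f t : 0 < t -> (t%:E < T)%E -> derivable_within D f t ->
  is_derive t (1 : R) f (derive_within D f t).
Proof.
move=> t0 tT; have It := time_interior t0 tT.
rewrite (derive_within_interior _ It) /derivable_within (within_shift_interior It) => df.
apply: DeriveDef; last by rewrite derive1E.
rewrite /derivable (_ : (fun h => _) = (fun h => h^-1 * (f (h + t) - f t)))//.
by apply/funext => h /=; rewrite /GRing.scale/= mulr1.
Qed.

(** Near 0, [f x] is [x] times a convergent difference quotient, plus [f 0]. *)
Lemma derivable_within_right_continuous f : D 0 -> derivable_within D f 0 ->
  f x @[x --> 0^'+] --> f 0.
Proof.
move=> D0 df; have := cvg_trans (cvg_app _ (punctured_right D0)) df.
move: (lim _) => l; under eq_fun do rewrite addr0.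
move=> fl; have : x * (x^-1 * (f x - f 0)) + f 0 @[x --> 0^'+] --> 0 * l + f 0.
  apply: cvgD; last exact: cvg_cst.
  by apply: cvgM => //; exact: cvg_at_right_filter cvg_id.
rewrite mul0r add0r; apply: cvg_trans; apply: near_eq_cvg.
near=> x; rewrite mulrA divff ?mul1r ?subrK// gt_eqF//.
Unshelve. all: by end_near. Qed.

End time_derivative.

(** * Energy conservation for a linear oscillator *)

Section oscillator.
Variables (R : realType) (T : \bar R) (n : nat) (M A : 'M[R]_n).
Variables x dx ddx : R -> 'rV[R]_n.
Notation D := (time_interval T).
Hypotheses (T0 : (0 < T)%E) (Msym : M^T = M) (Asym : A^T = A).
Hypothesis derx : forall t i, D t -> derivable_within D (fun s => x s 0 i) t /\
  derive_within D (fun s => x s 0 i) t = dx t 0 i.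
Hypothesis derdx : forall t i, D t -> derivable_within D (fun s => dx s 0 i) t /\
  derive_within D (fun s => dx s 0 i) t = ddx t 0 i.
Hypothesis motion : forall t, D t -> ddx t *m M = - 2 *: (x t *m A).

Let form (B : 'M[R]_n) (y z : 'rV[R]_n) : R := (y *m B *m z^T) 0 0.

Let formE B y z : form B y z = \sum_m (\sum_i y 0 i * B i m) * z 0 m.
Proof. by rewrite /form !mxE; apply: eq_bigr => m _; rewrite !mxE. Qed.

Let form_sym B y z : B^T = B -> form B y z = form B z y.
Proof.
by move=> Bs; rewrite /form -[y *m B *m _]trmxK [LHS]mxE !trmx_mul trmxK Bs mulmxA.
Qed.

(** The product rule gives two bilinear terms, which the symmetry of [B] merges into the factor
    2. *)
Let is_derive_form B (y : R -> 'rV[R]_n) (t : R) (dy : 'rV[R]_n) : B^T = B ->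
  (forall i, is_derive t (1 : R) (fun s : R => y s 0 i) (dy 0 i)) ->
  is_derive t (1 : R) (fun s : R => form B (y s) (y s)) (2 * form B dy (y t)).
Proof.
move=> Bs dyE.
have dB m : is_derive t (1 : R) (\sum_i (fun s : R => y s 0 i * B i m))
    (\sum_i (dy 0 i * B i m)).
  apply: is_derive_sum => i; have := is_deriveM (dyE i) (is_derive_cst (B i m) t (1 : R)).
  by move/is_derive_eq; apply; rewrite scaler0 add0r /GRing.scale/= mulrC.
have := is_derive_sum (fun m => is_deriveM (dB m) (dyE m)).
rewrite (_ : \sum_m _ = (fun s : R => form B (y s) (y s))); last first.
  apply/funext => s; rewrite formE fct_sumE; apply: eq_bigr => m _.
  by rewrite /GRing.mul/= fct_sumE.
move/is_derive_eq; apply.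
rewrite mulr_natl mulr2n -{1}(form_sym (y t) dy Bs) !formE -big_split/=.
by apply: eq_bigr => m _; rewrite fct_sumE /GRing.scale/= [y t 0 m * _]mulrC.
Qed.

Let energy t := 2^-1 * form M (dx t) (dx t) + form A (x t) (x t).

Let form_right B (y : R -> 'rV[R]_n) : (forall i, y s 0 i @[s --> 0^'+] --> (y 0 0 i : R)) ->
  form B (y s) (y s) @[s --> 0^'+] --> (form B (y 0) (y 0) : R).
Proof.
move=> cy; under eq_fun do rewrite formE.
rewrite formE; apply: cvg_sum => m; apply: cvgM => //.
by apply: cvg_sum => i; apply: cvgM => //; exact: cvg_cst.
Qed.

Lemma oscillator_energy t : 0 < t -> (t%:E < T)%E ->
  2^-1 * (dx t *m M *m (dx t)^T) 0 0 + (x t *m A *m (x t)^T) 0 0 =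
  2^-1 * (dx 0 *m M *m (dx 0)^T) 0 0 + (x 0 *m A *m (x 0)^T) 0 0.
Proof.
rewrite -!/(energy _) => t0 tT; have D0 : D 0 by split.
have Dt s : 0 < s <= t -> 0 < s /\ (s%:E < T)%E.
  by move=> /andP[s0 st]; split=> //; apply: le_lt_trans tT; rewrite lee_fin.
have dE s : 0 < s <= t -> is_derive s (1 : R) energy 0.
  move=> /Dt[s0 sT]; have Ds : D s by split=> //; exact: ltW.
  have dxs i : is_derive s (1 : R) (fun r => x r 0 i) (dx s 0 i).
    by have [dxi <-] := derx i Ds; exact: derive_within_is_derive.
  have ddxs i : is_derive s (1 : R) (fun r => dx r 0 i) (ddx s 0 i).
    by have [dxi <-] := derdx i Ds; exact: derive_within_is_derive.
  have := is_deriveD (is_deriveZ 2^-1 (is_derive_form Msym ddxs)) (is_derive_form Asym dxs).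
  move/is_derive_eq; apply.
  (* The equation of motion expresses the kinetic contribution through [A]; by symmetry it cancels
     the derivative of the potential part. *)
  have -> : form M (ddx s) (dx s) = - 2 * form A (x s) (dx s).
    by rewrite /form motion// -!scalemxAl mxE.
  by rewrite (form_sym (dx s) (x s) Asym) /GRing.scale/=; field.
(* The derivative vanishes at positive times only, so the mean value theorem on [0, t] also calls
   for right continuity at 0, obtained from the one-sided derivatives there. *)
have [| |c _] := @MVT _ energy (fun=> 0) 0 t t0.
- by move=> s; rewrite in_itv/= => /andP[s0 st]; apply: dE; rewrite s0 ltW.
- apply/continuous_within_itvP => //.
  have cE s : 0 < s <= t -> {for s, continuous energy}.
    by move=> /dE[ds _]; apply: differentiable_continuous; exact/derivable1_diffP.
  split.
  + by move=> s; rewrite in_itv/= => /andP[s0 st]; apply: cE; rewrite s0 ltW.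
  + apply: cvgD; first by apply: cvgM; [exact: cvg_cst|];
      apply: form_right => i; exact: derivable_within_right_continuous (derdx i D0).1.
    by apply: form_right => i; exact: derivable_within_right_continuous (derx i D0).1.
  + by apply: cvg_at_left_filter; apply: cE; rewrite t0 lexx.
by rewrite mul0r => /eqP; rewrite subr_eq0 => /eqP.
Qed.
End oscillator.

(** * Integration against the kernel weight *)

Section kernel_weight.
Variables (R : realType) (delta : R) (gamma : R -> R).
Hypothesis hgamma : admissible_kernel delta gamma.
Notation mu := (@lebesgue_measure R).

(** The weight is nonnegative, so its finite integral over the symmetric interval is that of its
    absolute value; integrability restricts to the right half. *)
Lemma kernel_integrable :
  mu.-integrable `]0, delta] (EFin \o (fun s => s ^+ 2 * gamma s)).
Proof.
have [mg g0 _ /andP[_ gfin]] := hgamma.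
have mw : measurable_fun `[- delta, delta] (EFin \o (fun s => s ^+ 2 * gamma s)).
  by apply/measurable_EFinP/measurable_funTS; exact: measurable_funM.
apply: (@integrableS _ (measurableTypeR R) _ mu `[- delta, delta]) => //.
  by move=> s; rewrite /= !in_itv/= => /andP[s0 sd]; rewrite sd andbT; lra.
apply/integrableP; split => //; apply: le_lt_trans gfin.
apply: ge0_le_integral => //; first exact: measurableT_comp.
by move=> s _; rewrite /= lee_fin ger0_norm// mulr_ge0 ?sqr_ge0.
Qed.

Definition wint (f : R -> R) : R :=
  \int[mu]_(s in `]0, delta]) (s ^+ 2 * gamma s * f s).

Lemma wint_integrable f : bmeas `]0, delta] f ->
  mu.-integrable `]0, delta] (EFin \o (fun s => s ^+ 2 * gamma s * f s)).
Proof.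
move=> [mf [B fB]].
have bf : [bounded f s | s in `]0, delta]].
  by exists B; split; [exact: num_real|move=> M BM s Ds; rewrite /= (le_trans (fB s Ds))// ltW].
exact: (@integrableMl _ (measurableTypeR R) R mu _ _ _ _ kernel_integrable mf bf).
Qed.

Lemma eq_wint f g : (forall s, 0 < s <= delta -> f s = g s) -> wint f = wint g.
Proof.
move=> fg; apply: eq_Rintegral => s; rewrite inE/= in_itv/= => sd.
by rewrite fg.
Qed.

Lemma wint_sum (I : Type) (r : seq I) (f : I -> R -> R) (c : I -> R) :
  (forall i, bmeas `]0, delta] (f i)) ->
  wint (fun s => \sum_(i <- r) f i s * c i) = \sum_(i <- r) wint (f i) * c i.
Proof.
move=> bf; pose F i s := s ^+ 2 * gamma s * (f i s * c i).
transitivity (\int[mu]_(s in `]0, delta]) (\sum_(i <- r) F i s)).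
  by apply: eq_Rintegral => s _; rewrite mulr_sumr.
rewrite (@Rintegral_sum _ (measurableTypeR R) R mu _ _ _ F)//; last first.
  by move=> i; apply: wint_integrable; apply: bmeasM => //; exact: bmeas_cst.
apply: eq_bigr => i _; rewrite /F; under eq_Rintegral do rewrite mulrA.
by rewrite RintegralZr//; exact: wint_integrable.
Qed.

Definition wint_mx n (A : R -> 'M[R]_n) : 'M[R]_n := \matrix_(i, j) wint (fun s => A s i j).

(** The vector does not depend on [s], so it leaves the integral entry by entry. *)
Lemma wint_row n (A : R -> 'M[R]_n) (c : 'rV[R]_n) j :
  (forall i j, bmeas `]0, delta] (fun s => A s i j)) ->
  wint (fun s => (c *m A s) 0 j) = (c *m wint_mx A) 0 j.
Proof.
move=> bA; transitivity (wint (fun s => \sum_i A s i j * c 0 i)).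
  by apply: eq_wint => s _; rewrite mxE; apply: eq_bigr => i _; rewrite mulrC.
by rewrite wint_sum// mxE; apply: eq_bigr => i _; rewrite mxE mulrC.
Qed.

Lemma wint_form n (A : R -> 'M[R]_n) (c d : 'rV[R]_n) :
  (forall i j, bmeas `]0, delta] (fun s => A s i j)) ->
  wint (fun s => (c *m A s *m d^T) 0 0) = (c *m wint_mx A *m d^T) 0 0.
Proof.
move=> bA; transitivity (wint (fun s => \sum_j (c *m A s) 0 j * d 0 j)).
  by apply: eq_wint => s _; rewrite mxE; apply: eq_bigr => j _; rewrite [d^T _ _]mxE.
rewrite wint_sum; last by move=> j; apply: bmeas_mulmx => // ? ?; exact: bmeas_cst.
by rewrite mxE; apply: eq_bigr => j _; rewrite wint_row// [d^T _ _]mxE.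
Qed.

End kernel_weight.

(** * Reduction of the scheme to the oscillator *)

Section semi_discrete_scheme.
Variables (R : realType) (a b : R) (N : nat) (xs : nat -> R) (k : nat).
Variables (delta : R) (gamma : R -> R) (T : \bar R).
Variables (u : R -> R -> R) (q : R -> R -> R -> R).
Hypotheses (hmesh : is_mesh a b N xs) (hgamma : admissible_kernel delta gamma).
Hypothesis hsol : DG_solution a b N xs k delta gamma T u q.
Notation mu := (@lebesgue_measure R).
Notation Vh := (Vh a b N xs k).
Notation D := (time_interval T).
Notation dof_node := (@dof_node R N xs k).
Notation shape := (@shape R a b N xs k).
Notation mass := (mass a b N xs k).
Notation coef := (@coef R N xs k).

(** Difference quotients in time at [x] and [x + (b - a)] coincide, which gives periodicity. On a
    cell, the expansion in shape functions is differentiated: its coefficients are values at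
    interior points, where [w] is differentiable in time. *)
Lemma dt_Vh (w : R -> R -> R) : (forall t, D t -> Vh (w ^~ t)) ->
  (forall j x t, (j < N)%N -> cell xs j x -> D t -> derivable_within D (w x) t) ->
  forall t, D t -> Vh (dt T w ^~ t).
Proof.
move=> wV dw t Dt; split=> [x|j jN].
  rewrite /dt /derive_within (@eq_derive_within _ T (w (x + (b - a))) (w x))//.
  by move=> s /wV[wp _]; exact: wp.
have [_ /(_ j jN)[p [sp pE]]] :=
  @shape_comb_Vh R a b N xs k hmesh (fun i => dt T w (dof_node i) t).
exists p; split=> // x jx; rewrite -pE//.
rewrite /dt /derive_within.
rewrite (@eq_derive_within _ T (w x) (fun s => \sum_i w (dof_node i) s * shape i x))//.
  have dwi i : derivable_within D (w (dof_node i)) t.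
    exact: dw (ltn_ord _) (dof_node_cell hmesh i) Dt.
  exact: (derive_within_sum _ _ Dt dwi).2.
by move=> s Ds; have := Vh_expand hmesh (wV s Ds) jN jx.
Qed.

Let uV t : D t -> Vh (u ^~ t).
Proof. by have [H _ _ _ _] := hsol; exact: H. Qed.

Let utV t : D t -> Vh (dt T u ^~ t).
Proof.
by have [_ _ H _ _] := hsol; apply: dt_Vh uV _ t => j x t jN jx /(H j x t jN jx)[].
Qed.

Let uttV t : D t -> Vh (dt T (dt T u) ^~ t).
Proof.
by have [_ _ H _ _] := hsol; apply: dt_Vh utV _ t => j x t jN jx /(H j x t jN jx)[].
Qed.

Let qV t s : D t -> 0 < s <= delta -> Vh (fun x => q x t s).
Proof. by have [_ H _ _ _] := hsol; exact: H. Qed.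

Let q_quotient t s : D t -> 0 < s <= delta -> forall m : 'I_(dofs N k),
  \int[mu]_(x in cell xs (dof_cell m)) (q x t s * shape m x) =
  Hop xs (dof_cell m) (u ^~ t) (shape m) s.
Proof.
have [_ _ _ _ H] := hsol => Dt sd m; apply/eqP; rewrite -subr_eq0; apply/eqP.
by apply: H => //; exact: shape_Vh.
Qed.

Notation nonloc := (nonloc a b N xs k).
Let A := wint_mx delta gamma nonloc.

Let wint_nonloc_bmeas (i j : 'I_(dofs N k)) : bmeas `]0, delta] (fun s => nonloc s i j).
Proof. exact: nonloc_bmeas. Qed.

(** Testing the first equation with [shape m] yields the entry [m]; the minus sign of [Kop_quotient]
    makes the force a restoring one. *)
Lemma scheme_motion t : D t ->
  coef (dt T (dt T u) ^~ t) *m mass = - 2 *: (coef (u ^~ t) *m A).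
Proof.
move=> Dt; have [_ _ _ H _] := hsol; apply/rowP => m; rewrite [RHS]mxE.
have := H _ t _ (ltn_ord (dof_cell m)) Dt (shape_Vh hmesh m).
rewrite (cell_massE hmesh m (uttV Dt)) => /eqP; rewrite subr_eq0 => /eqP ->.
rewrite mulNr -mulrN; congr (_ * _).
rewrite -wint_row//.
(* Writing the sign as a one-term sum lets [wint_sum] pull out the factor -1. *)
transitivity (wint delta gamma (fun s => \sum_(i < 1) (coef (u ^~ t) *m nonloc s) 0 m * -1)).
  apply: eq_wint => s sd; rewrite big_ord1 mulrN1.
  exact: Kop_quotient (uV Dt) (qV Dt sd) (q_quotient Dt sd) m.
rewrite wint_sum ?big_ord1 ?mulrN1// => _.
by apply: bmeas_mulmx => // ? ?; exact: bmeas_cst.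
Qed.

(** The kinetic part is the mass form of the nodal velocities, since [dt T u] stays in [Vh]; in the
    potential part, [q] is eliminated for each [s] before integration against the weight. *)
Lemma energyE t : D t -> energy a b delta gamma T u q t =
  2^-1 * (coef (dt T u ^~ t) *m mass *m (coef (dt T u ^~ t))^T) 0 0 +
  (coef (u ^~ t) *m A *m (coef (u ^~ t))^T) 0 0.
Proof.
move=> Dt; rewrite /energy; congr (_ + _).
  rewrite -(intp_mass hmesh (utV Dt) (utV Dt)) -intpZ; last first.
    by apply: tameM; exact: Vh_tame (utV Dt).
  by apply: eq_intp => x _; rewrite expr2.
rewrite -wint_form//; apply: eq_wint => s sd.
exact: intp_sqr_quotient (uV Dt) (qV Dt sd) (q_quotient Dt sd).
Qed.

End semi_discrete_scheme.

Theorem theorem2p4 (R : realType) (a b : R) (N : nat) (xs : nat -> R) (nu : R)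
    (k : nat) (delta : R) (gamma : R -> R) (T : \bar R)
    (u : R -> R -> R) (q : R -> R -> R -> R)
    (hab : a < b) (hmesh : is_mesh a b N xs)
    (hnu : 0 < nu) (hreg : regular_mesh nu N xs)
    (hdelta : 0 < delta) (hgamma : admissible_kernel delta gamma)
    (hT : (0 < T)%E)
    (hsol : DG_solution a b N xs k delta gamma T u q) :
  forall t : R, 0 < t -> (t%:E < T)%E ->
    energy a b delta gamma T u q t = energy a b delta gamma T u q 0.
Proof.
move=> t t0 tT; have [_ _ du _ _] := hsol.
rewrite !(energyE hmesh hgamma hsol); last first.
  by split=> //; exact: ltW.
  by split.
apply: (@oscillator_energy R T _ (mass a b N xs k)
  (wint_mx delta gamma (nonloc a b N xs k)) (fun s => coef N xs k (u ^~ s))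
  (fun s => coef N xs k (dt T u ^~ s)) (fun s => coef N xs k (dt T (dt T u) ^~ s))) => //.
- exact: mass_sym.
- apply/matrixP => i j; rewrite !mxE; apply: eq_wint => s _.
  by rewrite -[in LHS]nonloc_sym mxE.
(* A coefficient is the value at a fixed point inside a cell, where differentiability in time is
   assumed; the same holds for the velocity below. *)
- move=> s i Ds; rewrite [in X in _ /\ X]mxE.
  have [ui _] := du _ _ _ (ltn_ord _) (dof_node_cell hmesh i) Ds.
  by under eq_fun do rewrite mxE.
- move=> s i Ds; rewrite [in X in _ /\ X]mxE.
  have [_ ui] := du _ _ _ (ltn_ord _) (dof_node_cell hmesh i) Ds.
  by under eq_fun do rewrite mxE.
- by move=> s Ds; exact: scheme_motion hmesh hgamma hsol s Ds.
Qed.
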